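(* For any pseudo-hoop $A$, every state-morphism operator on $A$ is both a type I state operator and a type III state operator on $A$.
   Context: A pseudo-hoop is an algebra $(A,\odot,\rightarrow,\rightsquigarrow,1)$ of type $(2,2,2,0)$ such that for all $x,y,z\in A$: $x\odot 1=1\odot x=x$; $x\rightarrow x=x\rightsquigarrow x=1$; $(x\odot y)\rightarrow z=x\rightarrow(y\rightarrow z)$; $(x\odot y)\rightsquigarrow z=y\rightsquigarrow(x\rightsquigarrow z)$; $(x\rightarrow y)\odot x=(y\rightarrow x)\odot y=x\odot(x\rightsquigarrow y)=y\odot(y\rightsquigarrow x)$. The order is $x\le y$ iff $x\rightarrow y=1$; $x\wedge y=(x\rightarrow y)\odot x$. Put $x\vee_1 y=(x\rightarrow y)\rightsquigarrow y$, $x\vee_2 y=(x\rightsquigarrow y)\rightarrow y$. For $\mu:A\to A$ and all $x,y$ consider: (IS1) $\mu(x\rightarrow y)=\mu(x\vee_1 y)\rightarrow\mu(y)$ and $\mu(x\rightsquigarrow y)=\mu(x\vee_2 y)\rightsquigarrow\mu(y)$; (IS1'') $\mu(x\rightarrow y)=\mu(x)\rightarrow\mu(x\wedge y)$ and $\mu(x\rightsquigarrow y)=\mu(x)\rightsquigarrow\mu(x\wedge y)$; (IS2) $\mu(x\odot y)=\mu(x)\odot\mu(x\rightsquigarrow x\odot y)=\mu(y\rightarrow x\odot y)\odot\mu(y)$; (IS3) $\mu(\mu(x)\odot\mu(y))=\mu(x)\odot\mu(y)$; (IS4) $\mu(\mu(x)\rightarrow\mu(y))=\mu(x)\rightarrow\mu(y)$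 and $\mu(\mu(x)\rightsquigarrow\mu(y))=\mu(x)\rightsquigarrow\mu(y)$. Type I: (IS1),(IS2),(IS3),(IS4); type III: (IS1''),(IS2),(IS3),(IS4). A state-morphism operator is a map $\mu:A\to A$ with $\mu(x\odot y)=\mu(x)\odot\mu(y)$, $\mu(x\rightarrow y)=\mu(x)\rightarrow\mu(y)$, $\mu(x\rightsquigarrow y)=\mu(x)\rightsquigarrow\mu(y)$ for all $x,y$, and $\mu\circ\mu=\mu$. *)

(* Defs.v *)
Set Implicit Arguments.
Unset Strict Implicit.

Declare Scope pseudo_hoop_scope.
Delimit Scope pseudo_hoop_scope with PH.

Reserved Notation "x ⊙ y" (at level 40, left associativity).
Reserved Notation "x ⇾ y" (at level 55, right associativity).
Reserved Notation "x ⇝ y" (at level 55, right associativity).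

Record pseudoHoop : Type := PseudoHoop {
  carrier :> Type;
  mul : carrier -> carrier -> carrier  where "x ⊙ y" := (mul x y);
  impl : carrier -> carrier -> carrier where "x ⇾ y" := (impl x y);
  impr : carrier -> carrier -> carrier where "x ⇝ y" := (impr x y);
  one : carrier;
  mul_one_r : forall x, x ⊙ one = x;
  mul_one_l : forall x, one ⊙ x = x;
  impl_refl : forall x, (x ⇾ x) = one;
  impr_refl : forall x, (x ⇝ x) = one;
  impl_mul : forall x y z, ((x ⊙ y) ⇾ z) = (x ⇾ (y ⇾ z));
  impr_mul : forall x y z, ((x ⊙ y) ⇝ z) = (y ⇝ (x ⇝ z));
  (* The chain of four equal terms, as three consecutive equations. *)
  div_ll : forall x y, (x ⇾ y) ⊙ x = (y ⇾ x) ⊙ y;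
  div_lr : forall x y, (y ⇾ x) ⊙ y = x ⊙ (x ⇝ y);
  div_rr : forall x y, x ⊙ (x ⇝ y) = y ⊙ (y ⇝ x)
}.

Arguments one {_}.

Notation "x ⊙ y" := (mul x y) : pseudo_hoop_scope.
Notation "x ⇾ y" := (impl x y) : pseudo_hoop_scope.
Notation "x ⇝ y" := (impr x y) : pseudo_hoop_scope.

Local Open Scope pseudo_hoop_scope.

Definition meet (A : pseudoHoop) (x y : A) : A := (x ⇾ y) ⊙ x.
Definition join1 (A : pseudoHoop) (x y : A) : A := (x ⇾ y) ⇝ y.
Definition join2 (A : pseudoHoop) (x y : A) : A := (x ⇝ y) ⇾ y.

Definition IS1 (A : pseudoHoop) (mu : A -> A) : Prop :=
  forall x y : A,
    mu (x ⇾ y) = (mu (join1 x y) ⇾ mu y) /\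
    mu (x ⇝ y) = (mu (join2 x y) ⇝ mu y).

Definition IS1'' (A : pseudoHoop) (mu : A -> A) : Prop :=
  forall x y : A,
    mu (x ⇾ y) = (mu x ⇾ mu (meet x y)) /\
    mu (x ⇝ y) = (mu x ⇝ mu (meet x y)).

Definition IS2 (A : pseudoHoop) (mu : A -> A) : Prop :=
  forall x y : A,
    mu (x ⊙ y) = mu x ⊙ mu (x ⇝ (x ⊙ y)) /\
    mu (x ⊙ y) = mu (y ⇾ (x ⊙ y)) ⊙ mu y.

Definition IS3 (A : pseudoHoop) (mu : A -> A) : Prop :=
  forall x y : A, mu (mu x ⊙ mu y) = mu x ⊙ mu y.

Definition IS4 (A : pseudoHoop) (mu : A -> A) : Prop :=
  forall x y : A,
    mu (mu x ⇾ mu y) = (mu x ⇾ mu y) /\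
    mu (mu x ⇝ mu y) = (mu x ⇝ mu y).

Definition type_I_state_operator (A : pseudoHoop) (mu : A -> A) : Prop :=
  IS1 mu /\ IS2 mu /\ IS3 mu /\ IS4 mu.

Definition type_III_state_operator (A : pseudoHoop) (mu : A -> A) : Prop :=
  IS1'' mu /\ IS2 mu /\ IS3 mu /\ IS4 mu.

Record state_morphism_operator (A : pseudoHoop) (mu : A -> A) : Prop := {
  smo_mul : forall x y : A, mu (x ⊙ y) = mu x ⊙ mu y;
  smo_impl : forall x y : A, mu (x ⇾ y) = (mu x ⇾ mu y);
  smo_impr : forall x y : A, mu (x ⇝ y) = (mu x ⇝ mu y);
  smo_idem : forall x : A, mu (mu x) = mu x
}.

(* Main.v *)
(** A state-morphism operator commutes with all operations, so each axiom reduces to an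
    identity of pseudo-hoops: [join1 x y ⇾ y = x ⇾ y], [x ⇾ meet x y = x ⇾ y],
    [(y ⇾ x ⊙ y) ⊙ y = x ⊙ y] and their mirror images. These follow from the residuation
    law [a ⊙ x ≤ y <-> a ≤ x ⇾ y <-> x ≤ a ⇝ y] and antisymmetry. The mirror images come
    for free by passing to the opposite pseudo-hoop. *)
Require Import Defs.

Local Open Scope pseudo_hoop_scope.

(** Ended transparently, so that a lemma instantiated at [opposite A] is convertible to its mirror
    image in [A]. *)
Definition opposite (A : pseudoHoop) : pseudoHoop.
Proof.
refine (@PseudoHoop A (fun x y => y ⊙ x) (@impr A) (@impl A) one _ _ _ _ _ _ _ _ _).
- exact (@mul_one_l A).
- exact (@mul_one_r A).
- exact (@impr_refl A).
- exact (@impl_refl A).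
- intros x y z; apply impr_mul.
- intros x y z; apply impl_mul.
- exact (@div_rr A).
- exact (fun x y => eq_sym (div_lr y x)).
- exact (@div_ll A).
Defined.

Section PseudoHoopTheory.

Variable A : pseudoHoop.
Implicit Types a x y z : A.

Lemma impl_antisym x y : (x ⇾ y) = one -> (y ⇾ x) = one -> x = y.
Proof.
intros hxy hyx.
transitivity ((x ⇾ y) ⊙ x).
- now rewrite hxy, mul_one_l.
- now rewrite div_ll, hyx, mul_one_l.
Qed.

(* Associativity is not an axiom: both products have the same left residuals. *)
Lemma mul_assoc x y z : x ⊙ y ⊙ z = x ⊙ (y ⊙ z).
Proof.
assert (h : forall w, (x ⊙ y ⊙ z ⇾ w) = (x ⊙ (y ⊙ z) ⇾ w)).
{ intros w; now rewrite !impl_mul. }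
apply impl_antisym.
- now rewrite h, impl_refl.
- now rewrite <- h, impl_refl.
Qed.

(** The product [(a ⇾ one) ⊙ (a ⊙ x)] is evaluated twice: divisibility between [x] and [u = a ⊙ x]
    gives [x], while reassociating and absorbing [a ⇾ one] into [a] gives [u]. *)
Lemma one_impl x : (one ⇾ x) = x.
Proof.
set (u := one ⇾ x); set (a := x ⇾ one).
assert (hu : a ⊙ x = u) by (unfold a, u; now rewrite div_ll, mul_one_r).
assert (hxu : (x ⇾ u) = one).
{ unfold u; now rewrite <- impl_mul, mul_one_r, impl_refl. }
assert (hux : (u ⇾ x) = (a ⇾ one)) by now rewrite <- hu, impl_mul, impl_refl.
assert (ha : (a ⇾ one) ⊙ a = a).
{ rewrite div_ll, mul_one_r; unfold a.
  now rewrite <- impl_mul, mul_one_l. }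
assert (hx : (a ⇾ one) ⊙ u = x) by now rewrite <- hux, div_ll, hxu, mul_one_l.
now rewrite <- hu, <- mul_assoc, ha, hu in hx.
Qed.

Lemma impl_one x : (x ⇾ one) = one.
Proof.
assert (h : (x ⇾ one) ⊙ x = x) by now rewrite div_ll, mul_one_r, one_impl.
transitivity ((x ⇾ one) ⊙ x ⇾ one).
- now rewrite h.
- now rewrite impl_mul, impl_refl.
Qed.

(** Divisibility makes [x] a left multiple of [y], and currying then exposes [y ⇾ z]. *)
Lemma impl_trans x y z : (x ⇾ y) = one -> (y ⇾ z) = one -> (x ⇾ z) = one.
Proof.
intros hxy hyz.
assert (hx : (y ⇾ x) ⊙ y = x) by now rewrite div_ll, hxy, mul_one_l.
rewrite <- hx, impl_mul, hyz.
apply impl_one.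
Qed.

Lemma impl_mul_cancel x y : (y ⇾ x ⊙ y) ⊙ y = x ⊙ y.
Proof. now rewrite div_ll, impl_mul, impl_refl, impl_one, mul_one_l. Qed.

Lemma impl_meet x y : (x ⇾ meet x y) = (x ⇾ y).
Proof.
assert (hm : (meet x y ⇾ y) = one) by (unfold meet; now rewrite impl_mul, impl_refl).
apply impl_antisym.
- now rewrite <- impl_mul, div_ll, impl_mul, hm, impl_one.
- rewrite <- impl_mul; apply impl_refl.
Qed.

End PseudoHoopTheory.

(** The mixed divisibility law [div_lr] factors [x] as [y ⊙ (y ⇝ x)], a right multiple of [y]. *)
Lemma impr_one_of_impl (A : pseudoHoop) (x y : A) : (x ⇾ y) = one -> (x ⇝ y) = one.
Proof.
intros h.
assert (hx : y ⊙ (y ⇝ x) = x) by now rewrite <- div_lr, h, mul_one_l.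
rewrite <- hx, impr_mul, impr_refl.
exact (impl_one (opposite A) (y ⇝ x)).
Qed.

Lemma impl_one_iff_impr (A : pseudoHoop) (x y : A) : (x ⇾ y) = one <-> (x ⇝ y) = one.
Proof.
split.
- apply impr_one_of_impl.
- exact (impr_one_of_impl (opposite A) x y).
Qed.

(** Both sides express [a ⊙ x ≤ y], since the two arrows induce the same order. *)
Lemma impl_galois (A : pseudoHoop) (a x y : A) :
  (a ⇾ (x ⇾ y)) = one <-> (x ⇾ (a ⇝ y)) = one.
Proof.
rewrite <- impl_mul.
apply (iff_trans (impl_one_iff_impr A (a ⊙ x) y)).
rewrite impr_mul.
apply iff_sym, impl_one_iff_impr.
Qed.

(** This is the triple identity of the antitone Galois connection between [_ ⇾ y] and [_ ⇝ y]. *)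
Lemma join1_impl (A : pseudoHoop) (x y : A) : (join1 x y ⇾ y) = (x ⇾ y).
Proof.
apply impl_antisym.
- apply impl_galois, impl_trans with (join1 x y); apply impl_galois, impl_refl.
- apply impl_galois, impl_refl.
Qed.

Lemma join2_impr (A : pseudoHoop) (x y : A) : (join2 x y ⇝ y) = (x ⇝ y).
Proof. exact (join1_impl (opposite A) x y). Qed.

Lemma mul_impr_cancel (A : pseudoHoop) (x y : A) : x ⊙ (x ⇝ x ⊙ y) = x ⊙ y.
Proof. exact (impl_mul_cancel (opposite A) y x). Qed.

Lemma impr_meet (A : pseudoHoop) (x y : A) : (x ⇝ meet x y) = (x ⇝ y).
Proof.
(* Divisibility turns the meet into [x ⊙ (x ⇝ y)], which is the meet of [opposite A]. *)
unfold meet; rewrite div_ll, div_lr.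
exact (impl_meet (opposite A) x y).
Qed.

Theorem theorem6p4 (A : pseudoHoop) (mu : A -> A)
    (hmu : state_morphism_operator mu) :
  type_I_state_operator mu /\ type_III_state_operator mu.
Proof.
destruct hmu as [hmul himpl himpr hidem].
assert (h1 : IS1 mu).
{ intros x y; now rewrite <- himpl, <- himpr, join1_impl, join2_impr. }
assert (h1'' : IS1'' mu).
{ intros x y; now rewrite <- himpl, <- himpr, impl_meet, impr_meet. }
assert (h2 : IS2 mu).
{ intros x y; now rewrite <- !hmul, mul_impr_cancel, impl_mul_cancel. }
assert (h3 : IS3 mu) by (intros x y; now rewrite hmul, !hidem).
assert (h4 : IS4 mu) by (intros x y; now rewrite himpl, himpr, !hidem).
now repeat split; try apply h1; try apply h1''; try apply h2; try apply h4.
Qed.
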